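(* Consider an instance of $P|d_j=d,n_i\leq N|X$, let $S^*$ be an optimal schedule (for maximizing $X$, equivalently for minimizing $Y$), let $c>0$, and let $S_{LPT}$ be the schedule produced by capacitated list scheduling with the jobs ordered by non-increasing processing time (ties broken arbitrarily). If $X(S^* )<\varepsilon\cdot m\cdot d$ and $\varepsilon\leq 1/3$, then $X(S_{LPT})\geq(1-2\varepsilon)X(S^* )$ and $c\cdot p_{sum}+Y(S_{LPT})\leq(1+2\varepsilon/c)(c\cdot p_{sum}+Y(S^* ))$.
   Context: An instance consists of $m$ identical parallel machines, a set $\mathcal{J}$ of $n$ jobs with positive integer processing times $p_j$, a common due date $d$, and a machine capacity $N$ (a positive integer with $mN\geq n$). A feasible schedule assigns each job a machine and a start time such that jobs on the same machine do not overlap, there is no idle time between jobs on any machine, and each machine receives at most $N$ jobs. For a schedule $S$ with machine loads $P_i$, the early work is $X(S)=\sum_{i=1}^m\min\{d,P_i\}$, the late work is $Y(S)=\sum_{i=1}^m\max\{0,P_i-d\}$, and $p_{sum}=\sum_{j\in\mathcal{J}}p_j$ (so $X=p_{sum}-Y$). Capacitated list scheduling: start with $n_i=0$ and $L_i=0$ for every machine $i$; process the jobs in the given list order, and for the next job $j$ choose, among machines with $n_i<N$, a machine $i$ with minimum $L_i$ (ties broken arbitrarily); start $j$ on machine $i$ at time $L_i$, then set $L_i:=L_i+p_j$ and $n_i:=n_i+1$. Here $\varepsilon>0$. *)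

(* Defs.v *)
From mathcomp Require Import all_boot all_order all_algebra.

Set Implicit Arguments.
Unset Strict Implicit.
Unset Printing Implicit Defensive.

Import Order.TTheory GRing.Theory Num.Theory.
Local Open Scope ring_scope.

(* The due date may be any nonnegative element of R; in particular this covers
   integral due dates. *)
Record instance (R : realFieldType) := Instance {
  nmach : nat;
  job : finType;
  ptime : job -> nat;
  due : R;
  capacity : nat;
  ptime_gt0 : forall j, (0 < ptime j)%N;
  due_ge0 : 0 <= due;
  capacity_gt0 : (0 < capacity)%N;
  enough_capacity : (#|job| <= nmach * capacity)%N
}.

Record schedule (R : realFieldType) (I : instance R) := Schedule {
  machine : job I -> 'I_(nmach I);
  start : job I -> R
}.

Section Scheduling.
Variables (R : realFieldType) (I : instance R).
Implicit Types (S : schedule I) (i : 'I_(nmach I)) (j k : job I).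

Definition completion S j : R := start S j + (ptime j)%:R.

Definition no_overlap S : Prop :=
  forall j k, j != k -> machine S j = machine S k ->
    completion S j <= start S k \/ completion S k <= start S j.

(* Every machine works without interruption from time 0 on: a job starts
   either at time 0 or exactly when another job of its machine completes. *)
Definition no_idle S : Prop :=
  forall j, start S j = 0 \/
    exists k, machine S k = machine S j /\ completion S k = start S j.

Definition feasible S : Prop :=
  [/\ forall j, 0 <= start S j,
      no_overlap S,
      no_idle S
    & forall i, (#|[set j | machine S j == i]| <= capacity I)%N].

Definition load S i : R := \sum_(j | machine S j == i) (ptime j)%:R.

Definition early_work S : R := \sum_i Num.min (due I) (load S i).

Definition late_work S : R := \sum_i Num.max 0 (load S i - due I).

Definition psum : R := \sum_(j : job I) (ptime j)%:R.

Definition optimal S : Prop :=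
  feasible S /\ forall S', feasible S' -> early_work S' <= early_work S.

(* [list_run S cnt L s] holds when, from a state where machine i has received
   cnt i jobs of total length L i, S treats the remaining list s as capacitated
   list scheduling may do; ties are arbitrary since [machine S j] may be any
   least loaded machine among those with a free slot. *)
Fixpoint list_run S (cnt : 'I_(nmach I) -> nat) (L : 'I_(nmach I) -> R)
    (s : seq (job I)) : Prop :=
  if s is j :: s' then
    let i := machine S j in
    [/\ (cnt i < capacity I)%N,
        forall i', (cnt i' < capacity I)%N -> L i <= L i',
        start S j = L i
      & list_run S (fun i' => if i' == i then (cnt i').+1 else cnt i')
                   (fun i' => if i' == i then L i' + (ptime j)%:R else L i')
                   s']
  else True.

Definition list_schedule (s : seq (job I)) S : Prop :=
  list_run S (fun=> 0%N) (fun=> 0) s.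

Definition LPT_order (s : seq (job I)) : Prop :=
  perm_eq s (enum (job I)) /\ sorted (fun j k => (ptime k <= ptime j)%N) s.

Definition LPT_schedule S : Prop :=
  exists2 s, LPT_order s & list_schedule s S.

End Scheduling.

Arguments psum {R} I.

(* Main.v *)
Require Import Defs.
From mathcomp Require Import all_boot all_order all_algebra.
From mathcomp Require Import ring lra.
Import Order.TTheory GRing.Theory Num.Theory.
Local Open Scope ring_scope.

(** Truncate every processing time at the due date: q_j = min(d, p_j). No
    schedule has early work above the sum of the q_j. Let j be the first job of
    the list that pushes the truncated load of its machine above d; before j all
    truncated loads count fully towards the early work of LPT. The machine of j
    already holds a job at least as long as j, so its truncated load, and hence
    that of each machine with a free slot, is above d/2. As the early work is
    below eps m d, fewer than 2 eps m machines have a free slot, so more than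
    (1 - 2 eps) m N jobs precede j. These are the longest ones among at most m N
    jobs, so they carry a fraction 1 - 2 eps of the sum of the q_j. *)

(** Locates the job that breaks the bound [due I] on all truncated loads, together with the good
    prefix before it. *)
Lemma first_failure (T : Type) (P : pred (seq T)) (s : seq T) :
  P [::] ->
  P s \/ exists s1 j s2, [/\ s = s1 ++ j :: s2, P s1 & ~~ P (rcons s1 j)].
Proof.
move=> P0; elim/last_ind: s => [|s j [Ps|[s1 [k [s2 [-> P1 nP]]]]]]; first by left.
  case: (boolP (P (rcons s j))) => [|nP]; first by left.
  by right; exists s, j, [::]; rewrite cats1.
by right; exists s1, k, (rcons s2 j); rewrite rcons_cat.
Qed.

Lemma sum_fibers (R : realFieldType) (I : instance R) (S : schedule I)
    (g : job I -> R) (s : seq (job I)) :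
  \sum_i \sum_(k <- s | machine S k == i) g k = \sum_(k <- s) g k.
Proof.
rewrite (exchange_big_dep xpredT) //=; apply: eq_bigr => k _.
by rewrite (big_pred1 (machine S k)) // => i; rewrite /= eq_sym.
Qed.

(** The starting state is arbitrary so that the induction on [s1] goes through; [cnt'] and [L'] are
    the state just before [j]. *)
Lemma list_run_cat (R : realFieldType) (I : instance R) (S : schedule I)
    cnt (L : 'I_(nmach I) -> R) s1 j s2 :
  let cnt' i := (cnt i + count (fun k => machine S k == i) s1)%N in
  let L' i := L i + \sum_(k <- s1 | machine S k == i) (ptime k)%:R in
  list_run S cnt L (s1 ++ j :: s2) ->
  forall i, (cnt' i < capacity I)%N -> L' (machine S j) <= L' i.
Proof.
elim: s1 cnt L => [|k s1 IH] cnt L /=.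
  by case=> _ minL _ _ i; rewrite addn0 !big_nil !addr0; apply: minL.
case=> _ _ _ run i cnti; move: (IH _ _ run i).
rewrite !big_cons ![_ == machine S k]eq_sym.
have -> : ((if machine S k == i then (cnt i).+1 else cnt i) +
   count (fun k0 : job I => machine S k0 == i) s1 < capacity I)%N.
  by move: cnti; case: ifP => _ /=; rewrite ?addSnnS ?add0n.
move=> /(_ isT).
by case: ifP => _; case: ifP => _; rewrite -?addrA.
Qed.

Lemma min_sum_le (R : realFieldType) (T : Type) (d : R) (p : T -> R)
    (A : pred T) (s : seq T) :
  0 <= d -> (forall k, 0 <= p k) ->
  Num.min d (\sum_(k <- s | A k) p k) <= \sum_(k <- s | A k) Num.min d (p k).
Proof.
move=> d0 p0; elim: s => [|k s IH]; first by rewrite !big_nil ge_min lexx orbT.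
rewrite !big_cons; case: ifP => // _.
have := p0 k; have : 0 <= \sum_(i <- s | A i) p i by rewrite sumr_ge0.
move: IH; set x := \sum_(_ <- _ | _) p _; set y := \sum_(_ <- _ | _) _.
by rewrite !minEle; do 3 case: ifP => /= ?; lra.
Qed.

Lemma sum_min_le (R : realFieldType) (T : Type) (d : R) (p : T -> R)
    (A : pred T) (s : seq T) :
  \sum_(k <- s | A k) Num.min d (p k) <= \sum_(k <- s | A k) p k.
Proof. by apply: ler_sum => k _; rewrite ge_min lexx orbT. Qed.

Section TruncatedLoads.

Variables (R : realFieldType) (I : instance R).
Implicit Types (S : schedule I) (s : seq (job I)) (i : 'I_(nmach I)).

Definition tptime (j : job I) : R := Num.min (due I) (ptime j)%:R.

Local Notation q := tptime.

Definition tload S s i : R := \sum_(k <- s | machine S k == i) q k.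

Let q_ge0 j : 0 <= q j.
Proof. by rewrite le_min due_ge0 ler0n. Qed.

Let sum_tload S s : \sum_i tload S s i = \sum_(k <- s) q k.
Proof. exact: sum_fibers. Qed.

Let LPT_perm s : LPT_order s -> perm_eq s (index_enum (job I)).
Proof. by case=> + _; rewrite enumT. Qed.

Let loadE S s i : LPT_order s ->
  load S i = \sum_(k <- s | machine S k == i) (ptime k)%:R.
Proof. by move=> /LPT_perm ps; rewrite /load (perm_big _ ps). Qed.

Lemma early_work_le_tload S s : LPT_order s ->
  early_work S <= \sum_(k <- s) q k.
Proof.
move=> ls; rewrite -(sum_tload S); apply: ler_sum => i _.
by rewrite (loadE _ _ _ ls); apply: min_sum_le => [|k]; rewrite ?due_ge0 ?ler0n.
Qed.

(** A truncated load of [s1] is at most d by hypothesis and at most the real load, which [s2] can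
    only increase. *)
Lemma tload_le_early_work S s1 s2 : LPT_order (s1 ++ s2) ->
  (forall i, tload S s1 i <= due I) ->
  \sum_(k <- s1) q k <= early_work S.
Proof.
move=> ls le_d; rewrite -(sum_tload S); apply: ler_sum => i _.
rewrite le_min le_d (loadE _ _ _ ls) big_cat /=.
by rewrite ler_wpDr ?sumr_ge0 // sum_min_le.
Qed.

Lemma LPT_ptime_le s1 j s2 : LPT_order (s1 ++ j :: s2) ->
  (forall k, k \in s1 -> q j <= q k) /\ (forall k, k \in s2 -> q k <= q j).
Proof.
case=> _; rewrite sorted_pairwise; last first.
  by move=> a b c ab bc; apply: leq_trans bc ab.
rewrite pairwise_cat /= => /and3P[/allrelP r12 _ /andP[/allP r2 _]].
have q_mono a b : (ptime a <= ptime b)%N -> q a <= q b.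
  move=> ab; rewrite /tptime le_min ge_min lexx /= ge_min.
  by rewrite ler_nat ab orbT.
split=> k ks; apply: q_mono; last exact: r2.
by apply: r12; rewrite ?mem_head.
Qed.

(** The greedy rule compares real loads; this form transfers the comparison to truncated loads,
    since capping at d is monotone. *)
Lemma tloadE S s i : tload S s i <= due I ->
  tload S s i = Num.min (due I) (\sum_(k <- s | machine S k == i) (ptime k)%:R).
Proof.
move=> le_d; apply/eqP; rewrite eq_le le_min le_d sum_min_le /=.
by apply: min_sum_le => [|k]; rewrite ?due_ge0 ?ler0n.
Qed.

Lemma LPT_early_work_ge S s1 j s2 :
  LPT_order (s1 ++ j :: s2) -> list_schedule (s1 ++ j :: s2) S ->
  (forall i, tload S s1 i <= due I) ->
  due I < tload S s1 (machine S j) + q j ->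
  (capacity I)%:R * ((nmach I)%:R * due I - 2 * \sum_(k <- s1) q k)
    <= due I * (size s1)%:R.
Proof.
move=> ls /list_run_cat /= minL le_d gt_d.
have [ge_j _] := LPT_ptime_le _ _ _ ls.
have half : due I < 2 * tload S s1 (machine S j).
  (* If the machine of [j] were empty, [gt_d] would read d < [q j], which is impossible; any job
     already there is at least as long as [j]. *)
  suff : q j <= tload S s1 (machine S j) by lra.
  case: (boolP (has (fun k => machine S k == machine S j) s1)) => [|/hasPn none].
    case/hasP=> k ks mk; rewrite /tload (big_rem k) //= mk.
    by rewrite ler_wpDr ?ge_j ?sumr_ge0.
  move: gt_d; rewrite /tload big_seq_cond big_pred0 ?add0r => [|k].
    by rewrite ltNge ge_min lexx.
  by apply/negbTE/negP => /andP[/none /negbTE ->].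
have -> : (size s1)%:R = \sum_i (count (fun k => machine S k == i) s1)%:R :> R.
  rewrite -sum1_size natr_sum -(sum_fibers _ _ S); apply: eq_bigr => i _.
  by rewrite -sum1_count natr_sum.
rewrite -(sum_tload S) !mulr_sumr.
have -> : (nmach I)%:R * due I = \sum_(i < nmach I) due I.
  by rewrite sumr_const card_ord mulr_natl.
rewrite -sumrB mulr_sumr; apply: ler_sum => i _.
have t0 : 0 <= tload S s1 i by rewrite sumr_ge0.
have c0 : 0 <= (capacity I)%:R :> R by [].
have d0 := due_ge0 I.
(* A full machine holds at least N jobs of [s1], which pays for N d. On a machine with a free slot
   the left side is nonpositive, its truncated load being above d/2. *)
case: (leqP (capacity I) (count (fun k => machine S k == i) s1)) => [full|free].
  apply: (@le_trans _ _ ((capacity I)%:R * due I)).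
    by rewrite ler_wpM2l // lerBlDr lerDl mulr_ge0.
  by rewrite mulrC ler_wpM2l // ler_nat.
apply: (@le_trans _ _ 0); last by rewrite mulr_ge0.
rewrite mulr_ge0_le0 // subr_le0 (le_trans (ltW half)) // ler_wpM2l //.
rewrite (tloadE _ _ _ (le_d i)) (tloadE _ _ _ (le_d (machine S j))).
rewrite le_min ge_min lexx /= ge_min orbC.
by have := minL i free; rewrite !add0r => ->.
Qed.

End TruncatedLoads.

Lemma early_late_work (R : realFieldType) (I : instance R) (S : schedule I) :
  early_work S + late_work S = psum I.
Proof.
rewrite -big_split /= /psum -(sum_fibers _ _ S); apply: eq_bigr => i _.
rewrite /load /=; set x := \sum_(_ | _) _.
by rewrite minEle maxEle subr_ge0; case: ifP => _; lra.
Qed.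

Lemma LPT_early_work (R : realFieldType) (I : instance R)
    (S Slpt : schedule I) (eps : R) :
  LPT_schedule Slpt -> 0 < eps ->
  early_work S < eps * (nmach I)%:R * due I ->
  (1 - 2 * eps) * early_work S <= early_work Slpt.
Proof.
move=> [s ls run] e0 small.
have d0 := due_ge0 I.
have load0 (T : schedule I) i : 0 <= load T i :> R by rewrite sumr_ge0.
have early0 (T : schedule I) : 0 <= early_work T :> R.
  by apply: sumr_ge0 => i _; rewrite le_min d0 load0.
have S0 := early0 S; have Slpt0 := early0 Slpt.
(* In the second case the early work of [Slpt], hence the sum [A] over the prefix, also stays below
   eps m d. *)
case: (leP (early_work S) (early_work Slpt)) => [le_S|lt_S].
  have : 0 <= eps * early_work S by rewrite mulr_ge0 // ltW.
  lra.
have leS := early_work_le_tload _ _ S _ ls.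
have [||] := @first_failure _ (fun s' => [forall i, tload _ _ Slpt s' i <= due I]) s.
- by apply/forallP => i; rewrite /tload big_nil.
- move=> /forallP good; have := tload_le_early_work _ _ Slpt s [::].
  by rewrite cats0 => /(_ ls good); lra.
move=> [s1 [j [s2 [es /forallP le_d /forallPn[i]]]]]; rewrite -ltNge => gt_d.
(* Appending [j] changes only its own machine, so the overloaded machine is that one. *)
have {i gt_d} gt_d : due I < tload _ _ Slpt s1 (machine Slpt j) + tptime _ _ j.
  move: gt_d (le_d i); rewrite /tload -cats1 big_cat big_mkcond /=.
  rewrite -big_mkcond big_cons big_nil; case: eqP => [->|_]; first by rewrite addr0.
  by rewrite addr0 ltNge => /negbTE ->.
rewrite {}es in ls run leS.
have [ge_j le_j] := LPT_ptime_le _ _ _ _ _ ls.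
have prefix := LPT_early_work_ge _ _ _ _ _ _ ls run le_d gt_d.
have leA := tload_le_early_work _ _ _ _ _ ls le_d.
have size_s : (size s1)%:R + 1 + (size s2)%:R <= (nmach I)%:R * (capacity I)%:R :> R.
  rewrite -natrM -addrA nat1r -natrD ler_nat.
  move: (enough_capacity I); case: ls => /perm_size; rewrite size_cat /=.
  by rewrite -cardE => ->.
have geA : (size s1)%:R * tptime _ _ j <= \sum_(k <- s1) tptime _ _ k.
  rewrite -sum1_size natr_sum mulr_suml !big_seq.
  by apply: ler_sum => k ks; rewrite mul1r ge_j.
have leB : \sum_(k <- s2) tptime _ _ k <= (size s2)%:R * tptime _ _ j.
  rewrite -sum1_size natr_sum mulr_suml !big_seq.
  by apply: ler_sum => k ks; rewrite mul1r le_j.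
have x0 : 0 <= tptime _ _ j by rewrite le_min d0 ler0n.
move: leS; rewrite big_cat big_cons /=.
move: prefix leA size_s geA leB x0.
move: (\sum_(k <- s1) _) (\sum_(k <- s2) _) (tptime _ _ j) => A B x.
move: (size s1)%:R (size s2)%:R => F G prefix leA size_s geA leB x0 leS.
(* For eps at least 1/2 the claim is trivial; otherwise inequalities may be scaled by 1 - 2 eps. *)
have [half|half] := leP (1 - 2 * eps) 0.
  by apply: le_trans Slpt0; rewrite mulr_le0_ge0.
have d_gt0 : 0 < due I.
  by rewrite lt_neqAle d0 andbT; apply: contraTneq small => <-; rewrite mulr0 -leNgt.
have many : (1 - 2 * eps) * ((nmach I)%:R * (capacity I)%:R) <= F.
  rewrite -(ler_pM2l d_gt0); apply: le_trans prefix.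
  have : (capacity I)%:R * A <= (capacity I)%:R * (eps * (nmach I)%:R * due I).
    by rewrite ler_wpM2l //; lra.
  lra.
apply: le_trans leA.
have {}leS : (1 - 2 * eps) * early_work S <= (1 - 2 * eps) * (A + (x + B)).
  by rewrite ler_wpM2l // ltW.
apply: (le_trans leS).
(* At most m N - [F] jobs remain from [j] on, each with truncated time at most [x]. *)
have rest : x + B <= ((nmach I)%:R * (capacity I)%:R - F) * x.
  have : 0 <= ((nmach I)%:R * (capacity I)%:R - (F + 1 + G)) * x.
    by rewrite mulr_ge0 // subr_ge0.
  lra.
(* With [many], the right side is at most [F] x - (1 - 2 eps) [F] x = 2 eps [F] x, hence at most 2
   eps [A]; adding (1 - 2 eps) [A] gives [A]. *)
have : (1 - 2 * eps) * (x + B)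
    <= (1 - 2 * eps) * (((nmach I)%:R * (capacity I)%:R - F) * x).
  by rewrite ler_wpM2l // ltW.
have := ler_wpM2r x0 many.
have := ler_wpM2l (ltW e0) geA.
lra.
Qed.

Theorem theorem6 (R : realFieldType) (I : instance R)
    (Sopt Slpt : schedule I) (eps c : R) :
  optimal Sopt ->
  LPT_schedule Slpt ->
  0 < c ->
  0 < eps ->
  early_work Sopt < eps * (nmach I)%:R * due I ->
  eps <= 1 / 3 ->
  (1 - 2 * eps) * early_work Sopt <= early_work Slpt /\
  c * psum I + late_work Slpt
    <= (1 + 2 * eps / c) * (c * psum I + late_work Sopt).
Proof.
move=> _ lpt c0 e0 small _.
have X := LPT_early_work _ _ _ _ _ lpt e0 small; split=> //.
have := early_late_work _ _ Sopt; have := early_late_work _ _ Slpt => El Eo.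
have Y0 : 0 <= late_work Sopt.
  by apply: sumr_ge0 => i _; rewrite le_max lexx.
(* The loss in early work is at most 2 eps X(Sopt), and X(Sopt) is at most [psum I], so the term 2
   eps [psum I] covers it. *)
have -> : (1 + 2 * eps / c) * (c * psum I + late_work Sopt) =
  c * psum I + late_work Sopt + 2 * eps * psum I + 2 * eps / c * late_work Sopt.
  by field; rewrite gt_eqF.
have : 0 <= 2 * eps / c * late_work Sopt.
  by rewrite mulr_ge0 // divr_ge0 ?ltW // mulr_gt0.
have : 0 <= eps * late_work Sopt by rewrite mulr_ge0 // ltW.
nra.
Qed.
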